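(* Let $g\in\mathscr{L}$, let $\mathbb{A}=(A_1,\ldots,A_n)$ be an $n$-tuple of positive definite matrices in $\mathcal{M}_k$ with $mI\le A_i\le MI$ $(i=1,\ldots,n)$ for some scalars $0<m<M$, and let $w=(w_1,\ldots,w_n)$ be a weight vector. Put $h=\frac{M}{m}$. Then $$\sum_{i=1}^{n}w_iA_i\le \sum_{i=1}^{n}w_i\,M^{\frac{m^{-1}I-A_i^{-1}}{m^{-1}-M^{-1}}}\,m^{\frac{A_i^{-1}-M^{-1}I}{m^{-1}-M^{-1}}}\le K(h,2)\,\sigma_g(w;\mathbb{A}),$$ and $$\sigma_g(w;\mathbb{A})\le \sum_{i=1}^{n}w_i\,M^{\frac{m^{-1}I-A_i^{-1}}{m^{-1}-M^{-1}}}\,m^{\frac{A_i^{-1}-M^{-1}I}{m^{-1}-M^{-1}}}\le K(h,2)\left(\sum_{i=1}^{n}w_iA_i^{-1}\right)^{-1}.$$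
   Context: $\mathcal{M}_k$ is the algebra of complex $k\times k$ matrices, $I$ the identity matrix, and $A\le B$ for Hermitian matrices means $B-A$ is positive semidefinite. A weight vector is $w=(w_1,\ldots,w_n)$ with all $w_i>0$ and $\sum_{i=1}^n w_i=1$. $\mathscr{L}$ is the set of all operator monotone functions $g$ on $(0,\infty)$ (real-valued functions, applied to positive definite matrices by functional calculus, with $A\le B\Rightarrow g(A)\le g(B)$ for positive definite matrices of every size) satisfying $g(1)=0$ and $g'(1)=1$. For $g\in\mathscr{L}$, a weight vector $w$ and positive definite $\mathbb{A}=(A_1,\ldots,A_n)$, $\sigma_g(w;\mathbb{A})$ denotes the (unique) positive definite solution $X$ of the generalized Karcher equation $\sum_{i=1}^{n}w_i\,g\left(X^{-1/2}A_iX^{-1/2}\right)=0$. The Kantorovich constant is $K(h,2)=\frac{(h+1)^2}{4h}$. For a scalar $c>0$ and Hermitian $H$, $c^{H}$ is defined by functional calculus, i.e. $c^H=\exp((\log c)H)$; thus $M^{\frac{m^{-1}I-A_i^{-1}}{m^{-1}-M^{-1}}}m^{\frac{A_i^{-1}-M^{-1}I}{m^{-1}-M^{-1}}}$ is the function $t\mapsto M^{\frac{m^{-1}-t^{-1}}{m^{-1}-M^{-1}}}m^{\frac{t^{-1}-M^{-1}}{m^{-1}-M^{-1}}}$ applied to $A_i$. *)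

(* Defs.v *)
From mathcomp Require Import all_boot all_order all_algebra.
From mathcomp Require Import complex.
From mathcomp Require Import reals topology normedtype derive exp.
Set Implicit Arguments.
Unset Strict Implicit.
Unset Printing Implicit Defensive.
Import Order.TTheory GRing.Theory Num.Theory.
Import numFieldNormedType.Exports.
Local Open Scope ring_scope.
Local Open Scope complex_scope.
Local Open Scope sesquilinear_scope.

Definition psdmx (R : realType) k (A : 'M[R[i]]_k) : Prop :=
  A \is hermsymmx /\ forall u : 'rV[R[i]]_k, 0 <= (u *m A *m u ^t*) 0 0.

Definition pdmx (R : realType) k (A : 'M[R[i]]_k) : Prop :=
  A \is hermsymmx /\
  forall u : 'rV[R[i]]_k, u != 0 -> 0 < (u *m A *m u ^t*) 0 0.

(* Löwner order, meant for Hermitian arguments *)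
Definition lemx (R : realType) k (A B : 'M[R[i]]_k) : Prop := psdmx (B - A).

(* Functional calculus for Hermitian A = U^* diag(d) U, whose eigenvalues d are
   real; the result f(A) = U^* diag(f d) U does not depend on the chosen
   diagonalization. *)
Definition fcalc (R : realType) k (f : R -> R) (A : 'M[R[i]]_k) : 'M[R[i]]_k :=
  let U := spectralmx A in
  U ^t* *m diag_mx (map_mx (fun z => (f (complex.Re z))%:C) (spectral_diag A))
    *m U.

(* Only the values of g on (0, +oo) matter: the spectrum of a positive definite
   matrix is positive. *)
Definition operator_monotone (R : realType) (g : R -> R) : Prop :=
  forall k (A B : 'M[R[i]]_k),
    pdmx A -> pdmx B -> lemx A B -> lemx (fcalc g A) (fcalc g B).

Definition classL (R : realType) (g : R -> R) : Prop :=
  [/\ operator_monotone g, g 1 = 0 & is_derive (1 : R) (1 : R) g 1].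

Definition weight_vector (R : realType) n (w : 'I_n -> R) : Prop :=
  (forall i, 0 < w i) /\ \sum_(i < n) w i = 1.

Definition invsqrtmx (R : realType) k (X : 'M[R[i]]_k) : 'M[R[i]]_k :=
  fcalc (fun t => t `^ (- 2^-1)) X.

(* X = sigma_g(w; A): X is a positive definite solution of the generalized
   Karcher equation *)
Definition is_sigma (R : realType) k n (g : R -> R) (w : 'I_n -> R)
    (A : 'I_n -> 'M[R[i]]_k) (X : 'M[R[i]]_k) : Prop :=
  pdmx X /\
  \sum_(i < n) (w i)%:C *: fcalc g (invsqrtmx X *m A i *m invsqrtmx X) = 0.

(* c ^ H = exp ((log c) H); for c > 0, c `^ x = expR (x * ln c) *)
Definition scalar_powmx (R : realType) k (c : R) (H : 'M[R[i]]_k) :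
    'M[R[i]]_k :=
  fcalc (fun x => c `^ x) H.

Definition geom_interpmx (R : realType) k (m M : R) (A : 'M[R[i]]_k) :
    'M[R[i]]_k :=
  scalar_powmx M
    ((m^-1 - M^-1)^-1%:C *: ((m^-1)%:C%:M - invmx A)) *m
  scalar_powmx m
    ((m^-1 - M^-1)^-1%:C *: (invmx A - (M^-1)%:C%:M)).

(* K(h, p) at p = 2 *)
Definition kantorovich (R : realType) (h : R) : R := (h + 1) ^+ 2 / (4 * h).

(* Main.v *)
Require Import Defs.
From mathcomp Require Import all_boot all_order all_algebra.
From mathcomp Require Import complex.
From mathcomp Require Import classical_sets reals filter topology normedtype.
From mathcomp Require Import derive exp realfun.
From mathcomp Require Import ring lra.
Set Implicit Arguments.
Unset Strict Implicit.
Unset Printing Implicit Defensive.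
Import Order.TTheory GRing.Theory Num.Theory.
Import numFieldNormedType.Exports.
Local Open Scope classical_set_scope.
Local Open Scope ring_scope.
Local Open Scope complex_scope.
Local Open Scope sesquilinear_scope.

(* The operator mean sigma_g lies between the harmonic and the arithmetic means.
   Indeed 1 - 1/y <= g y <= y - 1 for g in L: comparing a rotated diag(1, y)
   with a diagonal 2 x 2 matrix, monotonicity of order 2 bounds t * g y from
   above by g (1 + t (y - 1) + t^2) and from below by g at a point
   1 + t (1 - 1/y) + O(t^2), and g' 1 = 1 gives both bounds as t -> 0+.
   Inserting them in the Karcher equation gives X <= sum w_i A_i and
   X^-1 <= sum w_i A_i^-1.
   The rest is scalar: on [m, M], the weighted AM-GM inequality yields
   t <= M^theta m^(1-theta) <= m + M - m M / t, and
   m + M - m M s <= K(M/m, 2) / s is a completed square. *)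

(** * Positive semidefinite matrices and the Löwner order *)

Section Hermitian.
Variable C : numClosedFieldType.

(* At C = R[i], psd, posdef, loewner and spectral_calc are convertible to psdmx,
   pdmx, lemx and fcalc, with f : R -> R read as z |-> (f (Re z))%:C. *)
Definition psd k (A : 'M[C]_k) : Prop :=
  A \is hermsymmx /\ forall u : 'rV[C]_k, 0 <= (u *m A *m u ^t*) 0 0.

Definition posdef k (A : 'M[C]_k) : Prop :=
  A \is hermsymmx /\
  forall u : 'rV[C]_k, u != 0 -> 0 < (u *m A *m u ^t*) 0 0.

Definition loewner k (A B : 'M[C]_k) : Prop := psd (B - A).

Definition spectral_calc k (f : C -> C) (A : 'M[C]_k) : 'M[C]_k :=
  (spectralmx A) ^t* *m diag_mx (map_mx f (spectral_diag A)) *m spectralmx A.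

(** For unitary [V] the rows of [V] are, up to conjugate transposition, eigenvectors for the entries
    of [d]. Keeping [V] free allows several functions of one matrix to be computed in a common
    eigenbasis, whichever basis [spectralmx] picks. *)
Definition unidiag k (V : 'M[C]_k) (d : 'rV[C]_k) : 'M[C]_k :=
  V ^t* *m diag_mx d *m V.

Lemma hermsymmxP k (A : 'M[C]_k) : reflect (A ^t* = A) (A \is hermsymmx).
Proof.
by rewrite is_hermitianmxE expr0 scale1r eq_sym; exact: eqP.
Qed.

Lemma adjmxM k l p (A : 'M[C]_(k, l)) (B : 'M[C]_(l, p)) :
  (A *m B) ^t* = B ^t* *m A ^t*.
Proof. by rewrite trmx_mul map_mxM. Qed.

Lemma adjmxD k l (A B : 'M[C]_(k, l)) : (A + B) ^t* = A ^t* + B ^t*.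
Proof. by rewrite linearD /= map_mxD. Qed.

Lemma adjmxZ k l (a : C) (A : 'M[C]_(k, l)) : (a *: A) ^t* = a^* *: A ^t*.
Proof. by rewrite linearZ /= map_mxZ. Qed.

Lemma psdD k (A B : 'M[C]_k) : psd A -> psd B -> psd (A + B).
Proof.
move=> [/hermsymmxP hA pA] [/hermsymmxP hB pB]; split.
  by apply/hermsymmxP; rewrite adjmxD hA hB.
by move=> u; rewrite mulmxDr mulmxDl mxE addr_ge0.
Qed.

Lemma psd0 k : psd (0 : 'M[C]_k).
Proof.
split; first by apply/hermsymmxP; rewrite trmx0 map_mx0.
by move=> u; rewrite mulmx0 mul0mx mxE.
Qed.

Lemma psdZ k (a : C) (A : 'M[C]_k) : 0 <= a -> psd A -> psd (a *: A).
Proof.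
move=> a0 [/hermsymmxP hA pA]; split.
  by apply/hermsymmxP; rewrite adjmxZ hA (CrealP _) // ger0_real.
by move=> u; rewrite -scalemxAr -scalemxAl mxE mulr_ge0.
Qed.

Lemma psd_sum k (I : finType) (F : I -> 'M[C]_k) :
  (forall i, psd (F i)) -> psd (\sum_i F i).
Proof.
by move=> h; elim/big_rec: _ => [|i x _ hx]; [exact: psd0|exact: psdD].
Qed.

(** A rectangular [S] also covers rank one matrices, as congruences of the 1 x 1 identity. *)
Lemma psd_congr k l (S : 'M[C]_(l, k)) (A : 'M[C]_k) :
  psd A -> psd (S *m A *m S ^t*).
Proof.
move=> [/hermsymmxP hA pA]; split.
  by apply/hermsymmxP; rewrite !adjmxM trmxCK hA mulmxA.
by move=> u; have := pA (u *m S); rewrite adjmxM !mulmxA.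
Qed.

Lemma posdef_congr k (S : 'M[C]_k) (A : 'M[C]_k) :
  S \in unitmx -> posdef A -> posdef (S *m A *m S ^t*).
Proof.
move=> uS [/hermsymmxP hA pA]; split.
  by apply/hermsymmxP; rewrite !adjmxM trmxCK hA mulmxA.
move=> u u0; have := pA (u *m S); rewrite adjmxM !mulmxA; apply.
by apply: contra_neq u0 => uS0; rewrite -(mulmxK uS u) uS0 mul0mx.
Qed.

Lemma psd_diag k (d : 'rV[C]_k) : (forall i, 0 <= d 0 i) -> psd (diag_mx d).
Proof.
move=> d0; split.
  apply/hermsymmxP; rewrite tr_diag_mx map_diag_mx; congr diag_mx.
  apply/rowP => i; rewrite !mxE. exact/CrealP/ger0_real/d0.
move=> u; rewrite mul_mx_diag mxE sumr_ge0 // => j _.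
by rewrite !mxE mulrAC mulr_ge0 ?mul_conjC_ge0.
Qed.

Lemma psd_entry_ge0 k (A : 'M[C]_k) i : psd A -> 0 <= A i i.
Proof.
move=> [_ /(_ (delta_mx 0 i))]; rewrite -rowE.
by rewrite trmx_delta map_delta_mx -colE !mxE.
Qed.

Lemma loewner_trans k (A B D : 'M[C]_k) :
  loewner A B -> loewner B D -> loewner A D.
Proof. by move=> h1 h2; have := psdD h2 h1; rewrite addrA subrK. Qed.

Lemma loewner_congr k l (S : 'M[C]_(l, k)) (A B : 'M[C]_k) :
  loewner A B -> loewner (S *m A *m S ^t*) (S *m B *m S ^t*).
Proof. by move=> h; rewrite /loewner -mulmxBl -mulmxBr; exact: psd_congr. Qed.

Lemma loewner_sumZ k (I : finType) (w : I -> C) (A B : I -> 'M[C]_k) :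
  (forall i, 0 <= w i) -> (forall i, loewner (A i) (B i)) ->
  loewner (\sum_i w i *: A i) (\sum_i w i *: B i).
Proof.
move=> w0 AB; rewrite /loewner -sumrB; apply: psd_sum => i.
by rewrite -scalerBr; apply: psdZ => //; exact: AB.
Qed.

(** * Functional calculus in an arbitrary eigenbasis *)

Lemma hermitian_unidiag k (A : 'M[C]_k) : A \is hermsymmx ->
  exists (V : 'M[C]_k) (d : 'rV[C]_k),
    [/\ V \is unitarymx, d \is a realmx & A = unidiag V d].
Proof.
move=> hA; exists (spectralmx A), (spectral_diag A).
split; [exact: spectral_unitarymx|exact: hermitian_spectral_diag_real|].
have /hermitian_normalmx /orthomx_spectralP := hA.
by rewrite invmx_unitary ?spectral_unitarymx.
Qed.

Section Unidiag.
Variables (k : nat) (V : 'M[C]_k).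
Implicit Types d e : 'rV[C]_k.
Hypothesis uV : V \is unitarymx.

Let VV : V *m V ^t* = 1%:M. Proof. exact/unitarymxP. Qed.
Let VV' : V ^t* *m V = 1%:M. Proof. exact: mulmx1C. Qed.

Lemma unidiagM d e :
  unidiag V d *m unidiag V e = unidiag V (\row_i (d 0 i * e 0 i)).
Proof.
rewrite /unidiag !mulmxA -(mulmxA _ V) VV mulmx1 -(mulmxA (V ^t*)).
by rewrite mulmx_diag.
Qed.

Lemma unidiagD d e : unidiag V d + unidiag V e = unidiag V (d + e).
Proof. by rewrite /unidiag linearD mulmxDr mulmxDl. Qed.

Lemma unidiagZ a d : a *: unidiag V d = unidiag V (a *: d).
Proof. by rewrite /unidiag linearZ /= -scalemxAr -scalemxAl. Qed.

Lemma unidiagN d : - unidiag V d = unidiag V (- d).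
Proof. by rewrite -scaleN1r unidiagZ scaleN1r. Qed.

Lemma unidiag_const a : unidiag V (const_mx a) = a%:M.
Proof. by rewrite /unidiag diag_const_mx scalar_mxC -mulmxA VV' mulmx1. Qed.

Lemma unidiag_inv (d : 'rV[C]_k) : (forall i, d 0 i != 0) ->
  invmx (unidiag V d) = unidiag V (map_mx GRing.inv d).
Proof.
move=> d0.
have E : unidiag V d *m unidiag V (map_mx GRing.inv d) = 1%:M.
  rewrite unidiagM -[RHS](unidiag_const 1); congr unidiag.
  by apply/rowP => i; rewrite !mxE mulfV.
have [uA _] := mulmx1_unit E.
by rewrite -[LHS]mulmx1 -E mulKmx.
Qed.

Lemma unidiag_psd d : (forall i, 0 <= d 0 i) -> psd (unidiag V d).
Proof.
by move=> d0; rewrite /unidiag -{2}(trmxCK V); apply/psd_congr/psd_diag.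
Qed.

Lemma unidiag_le d e : (forall i, d 0 i <= e 0 i) ->
  loewner (unidiag V d) (unidiag V e).
Proof.
move=> de; rewrite /loewner unidiagN unidiagD; apply: unidiag_psd => i.
by rewrite !mxE subr_ge0.
Qed.

(** Evaluating the quadratic form at an eigenvector isolates one eigenvalue; this turns Löwner
    inequalities back into scalar ones. *)
Lemma unidiag_form d i :
  (row i V *m unidiag V d *m (row i V) ^t*) 0 0 = d 0 i.
Proof.
have E : V *m unidiag V d *m V ^t* = diag_mx d.
  by rewrite /unidiag !mulmxA VV mul1mx -(mulmxA (diag_mx d)) VV mulmx1.
have -> : row i V *m unidiag V d *m (row i V) ^t* =
    delta_mx 0 i *m diag_mx d *m (delta_mx 0 i) ^t*.
  by rewrite -E rowE adjmxM !mulmxA.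
rewrite -rowE.
by rewrite trmx_delta map_delta_mx -colE !mxE eqxx.
Qed.

Lemma unidiag_psd_ge0 d : psd (unidiag V d) -> forall i, 0 <= d 0 i.
Proof. by move=> [_ p] i; have := p (row i V); rewrite unidiag_form. Qed.

Lemma unidiag_posdef_gt0 d : posdef (unidiag V d) -> forall i, 0 < d 0 i.
Proof.
move=> [_ p] i; have := p (row i V); rewrite unidiag_form; apply.
apply/eqP => r0; have /row_unitarymxP/(_ i i) := uV.
by rewrite r0 eqxx dotmxE mul0mx mxE => /eqP; rewrite eq_sym oner_eq0.
Qed.

Lemma unidiag_posdef d : (forall i, 0 < d 0 i) -> posdef (unidiag V d).
Proof.
move=> d0; have [h p] := unidiag_psd (fun i => ltW (d0 i)); split=> // u u0.
have := p u; rewrite le_eqVlt => /orP[/eqP/esym f0|//].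
exfalso; move: f0.
(* In the eigenbasis the form is the sum of the terms [d_j |v_j|^2], all nonnegative. If it
   vanishes, so does [v], and then [u = v V] is zero. *)
have -> : u *m unidiag V d *m u ^t* =
    (u *m V ^t*) *m diag_mx d *m (u *m V ^t*) ^t*.
  by rewrite adjmxM trmxCK /unidiag !mulmxA.
set v := u *m V ^t*.
rewrite mul_mx_diag mxE => /eqP; rewrite psumr_eq0; last first.
  by move=> j _; rewrite !mxE mulrAC mulr_ge0 ?mul_conjC_ge0 // ltW.
move=> /allP v0; case/eqP: u0; rewrite -(mulmx1 u) -VV' mulmxA -/v.
suff -> : v = 0 by rewrite mul0mx.
apply/rowP => j; rewrite mxE; have := v0 j (mem_index_enum j).
by rewrite !mxE /= mulrAC mulf_eq0 mul_conjC_eq0 (gt_eqF (d0 j)) orbF => /eqP.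
Qed.

(* An eigenbasis of the chosen diagonalization and V are intertwined by a
   matrix W with s_i W_ij = W_ij d_j, and then f s_i W_ij = W_ij f d_j. *)
Lemma spectral_calc_unidiag f d :
  spectral_calc f (unidiag V d) = unidiag V (map_mx f d).
Proof.
set A := unidiag V d.
set U := spectralmx A; have uU : U \is unitarymx := spectral_unitarymx A.
have UU : U *m U ^t* = 1%:M by exact/unitarymxP.
have UU' : U ^t* *m U = 1%:M by exact: mulmx1C.
set s := spectral_diag A.
have AE : A = unidiag U s.
  have /orthomx_spectralP : A \is normalmx.
    by apply/orthomx_spectral_subproof; exists (V, d); rewrite ?invmx_unitary.
  by rewrite invmx_unitary.
pose W := U *m V ^t*.
have WE : diag_mx s *m W = W *m diag_mx d.
  have : U *m A *m V ^t* = U *m A *m V ^t* by [].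
  rewrite {1}AE /A /unidiag !mulmxA UU mul1mx => ->.
  by rewrite -(mulmxA _ V) VV mulmx1 /W.
have WF : diag_mx (map_mx f s) *m W = W *m diag_mx (map_mx f d).
  apply/matrixP => a b; move/matrixP: WE => /(_ a b).
  rewrite !mul_diag_mx !mul_mx_diag; move: W => W'; rewrite !mxE.
  have [->|x0] := eqVneq (W' a b) 0; first by rewrite !(mulr0, mul0r).
  by rewrite ![_ * W' a b]mulrC => /(mulfI x0) ->.
rewrite /spectral_calc -/U -/s /unidiag -[LHS]mulmx1 -VV' mulmxA.
rewrite -(mulmxA _ U) -[U *m V ^t*]/W.
by rewrite -(mulmxA (U ^t*)) WF /W !mulmxA UU' mul1mx.
Qed.

End Unidiag.

Lemma posdef_unidiag k (A : 'M[C]_k) : posdef A ->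
  exists (V : 'M[C]_k) (d : 'rV[C]_k),
    [/\ V \is unitarymx, forall i, 0 < d 0 i & A = unidiag V d].
Proof.
move=> pA; have [V [d [uV _ AE]]] := hermitian_unidiag pA.1.
by exists V, d; split=> //; apply: (unidiag_posdef_gt0 uV); rewrite -AE.
Qed.

Lemma posdef_unitmx k (A : 'M[C]_k) : posdef A -> A \in unitmx.
Proof.
move=> /posdef_unidiag[V [d [uV d0 ->]]].
have /mulmx1_unit[] // : unidiag V d *m unidiag V (map_mx GRing.inv d) = 1%:M.
rewrite unidiagM // -[RHS](unidiag_const uV 1); congr unidiag.
by apply/rowP => i; rewrite !mxE mulfV // gt_eqF.
Qed.

Lemma invmxM k (A B : 'M[C]_k) : A \in unitmx -> B \in unitmx ->
  invmx (A *m B) = invmx B *m invmx A.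
Proof.
move=> uA uB; have uAB : A *m B \in unitmx by rewrite unitmx_mul uA.
have E : (A *m B) *m (invmx B *m invmx A) = 1%:M.
  by rewrite mulmxA mulmxK // mulmxV.
by rewrite -[LHS]mulmx1 -E mulKmx.
Qed.

Lemma unidiag_adj k (V : 'M[C]_k) (d : 'rV[C]_k) : d \is a realmx ->
  (unidiag V d) ^t* = unidiag V d.
Proof.
move=> /mxOverP dR; rewrite /unidiag !adjmxM trmxCK tr_diag_mx.
rewrite map_diag_mx mulmxA; congr (_ *m diag_mx _ *m _).
apply/rowP => i; rewrite !mxE.
exact/CrealP.
Qed.

Lemma posdef_invsqrt k (Z : 'M[C]_k) : posdef Z ->
  exists2 T : 'M[C]_k, T ^t* = T & T *m T = invmx Z.
Proof.
move=> /posdef_unidiag[V [d [uV d0 ->]]].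
have sd i : 0 < sqrtC (d 0 i) by rewrite sqrtC_gt0.
exists (unidiag V (map_mx (fun x => (sqrtC x)^-1) d)).
  apply: unidiag_adj; apply/mxOverP => a i; rewrite ord1 mxE.
  by rewrite ger0_real // invr_ge0 ltW.
rewrite unidiagM // unidiag_inv //; last by move=> i; rewrite gt_eqF.
by congr unidiag; apply/rowP => i; rewrite !mxE -invfM -expr2 sqrtCK.
Qed.

(* Q = Z^(-1/2) P Z^(-1/2) satisfies Q <= 1, hence 1 <= Q^-1. *)
Lemma loewner_invmx k (P Z : 'M[C]_k) : posdef P -> posdef Z ->
  loewner P Z -> loewner (invmx Z) (invmx P).
Proof.
move=> pP pZ PZ; have [T TT TE] := posdef_invsqrt pZ.
have uZ := posdef_unitmx pZ; have uP := posdef_unitmx pP.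
have uT : T \in unitmx.
  have : T *m T \in unitmx by rewrite TE unitmx_inv.
  by rewrite unitmx_mul => /andP[].
have TZT : T *m Z *m T ^t* = 1%:M.
  rewrite TT -(invmxK Z) -TE invmxM // mulmxA mulmxV // mul1mx.
  by rewrite mulVmx.
have := posdef_congr uT pP; have := loewner_congr T PZ; rewrite TZT.
set Q := T *m P *m T ^t* => Q1 pQ.
have [W [e [uW e0 QE]]] := posdef_unidiag pQ.
have : loewner 1%:M (invmx Q).
  rewrite QE unidiag_inv //; last by move=> i; rewrite gt_eqF.
  rewrite -(unidiag_const uW 1); apply: unidiag_le => i; rewrite !mxE.
  rewrite invf_ge1 //; move: Q1.
  rewrite /loewner QE -(unidiag_const uW 1) unidiagN unidiagD.
  by move=> /(unidiag_psd_ge0 uW)/(_ i); rewrite !mxE subr_ge0.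
move=> /(loewner_congr T); rewrite mulmx1 TT TE /Q TT.
by rewrite !invmxM ?unitmx_mul ?uT // !mulmxA mulmxV // mul1mx mulmxKV.
Qed.

(** * Operator inequalities from the Karcher equation *)

(** Here [S] stands for [X^(-1/2)]. With [Y_i = S A_i S] and [T = S^-1], one has
    [T (Y_i - 1) T = A_i - X] and [S (1 - Y_i^-1) S = X^-1 - A_i^-1]. So the upper bound on [g] is
    conjugated by [T], the lower one by [S], and both are averaged with the weights. *)
Lemma karcher_bounds k (I : finType) (w : I -> C) (A : I -> 'M[C]_k)
    (X S : 'M[C]_k) (g : C -> C) :
  (forall x, 0 < x -> 1 - x^-1 <= g x /\ g x <= x - 1) ->
  S ^t* = S -> S *m X *m S = 1%:M ->
  (forall i, 0 <= w i) -> \sum_i w i = 1 -> (forall i, posdef (A i)) ->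
  \sum_i w i *: spectral_calc g (S *m A i *m S) = 0 ->
  loewner X (\sum_i w i *: A i) /\
  loewner (invmx X) (\sum_i w i *: invmx (A i)).
Proof.
move=> gB SS SXS w0 w1 pA K.
have [_ uS] := mulmx1_unit SXS.
pose T := invmx S; have uT : T \in unitmx by rewrite unitmx_inv.
have TS : T *m S = 1%:M by exact: mulVmx.
have ST : S *m T = 1%:M by exact: mulmxV.
have TT : T ^t* = T.
  have E : S *m T ^t* = 1%:M by rewrite -{1}SS -adjmxM TS trmx1 map_mx1.
  by rewrite -[LHS]mul1mx -TS -mulmxA E mulmx1.
have XE : X = T *m T.
  by rewrite -{1}(mulmx1 T) -SXS !mulmxA TS mul1mx -mulmxA ST mulmx1.
have iXE : invmx X = S *m S by rewrite XE invmxM // /T invmxK.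
have pY i : posdef (S *m A i *m S) by rewrite -{2}SS; exact: posdef_congr.
have sumB (F : I -> 'M[C]_k) Y :
    \sum_i w i *: (F i - Y) = \sum_i w i *: F i - Y.
  under eq_bigr do rewrite scalerBr.
  by rewrite sumrB -scaler_suml w1 scale1r.
(* The Karcher equation survives conjugation; it is used with [Z = T] and with [Z = S]. *)
have cK (Z : 'M[C]_k) :
    \sum_i w i *: (Z *m spectral_calc g (S *m A i *m S) *m Z ^t*) = 0.
  under eq_bigr do rewrite scalemxAl scalemxAr.
  by rewrite -mulmx_suml -mulmx_sumr K mulmx0 mul0mx.
split.
  have h i : loewner (T *m spectral_calc g (S *m A i *m S) *m T ^t*) (A i - X).
    have -> : A i - X = T *m (S *m A i *m S - 1%:M) *m T ^t*.
      rewrite TT mulmxBr mulmxBl mulmx1 -XE !mulmxA TS mul1mx.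
      by rewrite -(mulmxA _ S) ST mulmx1.
    apply: loewner_congr; have [V [d [uV d0 ->]]] := posdef_unidiag (pY i).
    rewrite spectral_calc_unidiag // -(unidiag_const uV 1) unidiagN unidiagD.
    by apply: unidiag_le => // j; rewrite !mxE; have [] := gB _ (d0 j).
  by have := loewner_sumZ w0 h; rewrite cK sumB /loewner subr0.
have h i : loewner (invmx X - invmx (A i))
    (S *m spectral_calc g (S *m A i *m S) *m S ^t*).
  have -> : invmx X - invmx (A i) =
      S *m (1%:M - invmx (S *m A i *m S)) *m S ^t*.
    have uA := posdef_unitmx (pA i).
    rewrite !invmxM ?unitmx_mul ?uS // -/T SS mulmxBr mulmxBl mulmx1 -iXE.
    by rewrite !mulmxA ST mul1mx -(mulmxA _ T) TS mulmx1.
  apply: loewner_congr; have [V [d [uV d0 ->]]] := posdef_unidiag (pY i).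
  rewrite spectral_calc_unidiag // -(unidiag_const uV 1).
  rewrite unidiag_inv //; last by move=> j; rewrite gt_eqF.
  rewrite unidiagN unidiagD.
  by apply: unidiag_le => // j; rewrite !mxE; have [] := gB _ (d0 j).
have := loewner_sumZ w0 h; rewrite cK /loewner sub0r.
have -> : \sum_i w i *: (invmx X - invmx (A i)) =
    - \sum_i w i *: (invmx (A i) - invmx X).
  by rewrite -sumrN; apply: eq_bigr => i _; rewrite -scalerN opprB.
by rewrite opprK sumB.
Qed.

Lemma posdefDl k (A B : 'M[C]_k) : psd A -> posdef B -> posdef (A + B).
Proof.
move=> pA [hB pB]; have [_ pA'] := pA; split.
  by apply/hermsymmxP; rewrite adjmxD !(hermsymmxP _ _) //; case: pA.
by move=> u u0; rewrite mulmxDr mulmxDl mxE ltr_wpDl // pB.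
Qed.

Lemma posdef_invmx k (A : 'M[C]_k) : posdef A -> posdef (invmx A).
Proof.
move=> /posdef_unidiag[V [d [uV d0 ->]]].
rewrite unidiag_inv //; last by move=> i; rewrite gt_eqF.
by apply: unidiag_posdef => // i; rewrite mxE invr_gt0.
Qed.

Lemma spectral_calc_ext k (f1 f2 : C -> C) (A : 'M[C]_k) : posdef A ->
  (forall x, 0 < x -> f1 x = f2 x) -> spectral_calc f1 A = spectral_calc f2 A.
Proof.
move=> /posdef_unidiag[V [d [uV d0 ->]]] f12.
rewrite !spectral_calc_unidiag //; congr unidiag.
by apply/rowP => i; rewrite !mxE f12.
Qed.

(** Both factors are diagonal in an eigenbasis of [A], so their product is a single function of [A].
    This rewrites [geom_interpmx] as a functional calculus. *)
Lemma spectral_calc_inv_affine k (f1 f2 : C -> C) (a b c : C) (A : 'M[C]_k) :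
  posdef A ->
  spectral_calc f1 (a *: (b%:M - invmx A)) *m
  spectral_calc f2 (a *: (invmx A - c%:M)) =
  spectral_calc (fun z => f1 (a * (b - z^-1)) * f2 (a * (z^-1 - c))) A.
Proof.
move=> /posdef_unidiag[V [d [uV d0 ->]]].
rewrite unidiag_inv //; last by move=> i; rewrite gt_eqF.
rewrite -(unidiag_const uV b) -(unidiag_const uV c) !unidiagN !unidiagD.
rewrite !unidiagZ !spectral_calc_unidiag // unidiagM //; congr unidiag.
by apply/rowP => i; rewrite !mxE.
Qed.

(** With [Z] the weighted sum of the inverses, the chain is [sum w_i phi(A_i) <= a - b Z <= K Z^-1
    <= K X]. The middle expression is affine in [A_i^-1], which is why averaging produces exactly
    [Z]. *)
Lemma interp_bounds k (I : finType) (w : I -> C) (A : I -> 'M[C]_k)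
    (X S : 'M[C]_k) (g phi : C -> C) (m M a b K : C) :
  (forall x, 0 < x -> 1 - x^-1 <= g x /\ g x <= x - 1) ->
  (forall x, m <= x -> x <= M -> x <= phi x /\ phi x <= a - b * x^-1) ->
  (forall x, 0 < x -> a - b * x <= K * x^-1) -> 0 <= K ->
  S ^t* = S -> S *m X *m S = 1%:M -> posdef X ->
  (forall i, 0 <= w i) -> \sum_i w i = 1 -> (forall i, posdef (A i)) ->
  (forall i, loewner m%:M (A i)) -> (forall i, loewner (A i) M%:M) ->
  \sum_i w i *: spectral_calc g (S *m A i *m S) = 0 ->
  (loewner (\sum_i w i *: A i) (\sum_i w i *: spectral_calc phi (A i)) /\
   loewner (\sum_i w i *: spectral_calc phi (A i)) (K *: X)) /\
  (loewner X (\sum_i w i *: spectral_calc phi (A i)) /\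
   loewner (\sum_i w i *: spectral_calc phi (A i))
           (K *: invmx (\sum_i w i *: invmx (A i)))).
Proof.
move=> gB phiB aK K0 SS SXS pX w0 w1 pA mA AM eqK.
have [XA iXA] := karcher_bounds gB SS SXS w0 w1 pA eqK.
set Z := \sum_i w i *: invmx (A i) in iXA *.
(* [Z] dominates the positive definite [X^-1]. *)
have pZ : posdef Z.
  by rewrite -(subrK (invmx X) Z); exact/posdefDl/posdef_invmx.
have h1 : loewner (\sum_i w i *: A i) (\sum_i w i *: spectral_calc phi (A i)).
  apply: loewner_sumZ => // i; move: (pA i) (mA i) (AM i).
  move=> /posdef_unidiag[V [d [uV d0 ->]]].
  rewrite /loewner -(unidiag_const uV m) -(unidiag_const uV M).
  rewrite spectral_calc_unidiag // !unidiagN !unidiagD.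
  move=> /(unidiag_psd_ge0 uV) md /(unidiag_psd_ge0 uV) dM.
  (* The bounds on [A i] place its eigenvalues in [[m, M]], where [phi] is controlled. *)
  apply: unidiag_psd => // j; have := md j; have := dM j.
  by rewrite !mxE !subr_ge0 => dM' md'; have [] := phiB _ md' dM'.
have h2 : loewner (\sum_i w i *: spectral_calc phi (A i)) (a%:M - b *: Z).
  have -> : a%:M - b *: Z = \sum_i w i *: (a%:M - b *: invmx (A i)).
    under [RHS]eq_bigr do rewrite scalerBr scalerA mulrC -scalerA.
    by rewrite sumrB -scaler_suml w1 scale1r -scaler_sumr.
  apply: loewner_sumZ => // i; move: (pA i) (mA i) (AM i).
  move=> /posdef_unidiag[V [d [uV d0 ->]]].
  rewrite unidiag_inv //; last by move=> j; rewrite gt_eqF.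
  rewrite /loewner -(unidiag_const uV m) -(unidiag_const uV M).
  rewrite -(unidiag_const uV a) unidiagZ.
  rewrite spectral_calc_unidiag // !unidiagN !unidiagD.
  move=> /(unidiag_psd_ge0 uV) md /(unidiag_psd_ge0 uV) dM.
  apply: unidiag_psd => // j; have := md j; have := dM j.
  by rewrite !mxE !subr_ge0 => dM' md'; have [] := phiB _ md' dM'.
have h3 : loewner (a%:M - b *: Z) (K *: invmx Z).
  have [V [d [uV d0 ->]]] := posdef_unidiag pZ.
  rewrite unidiag_inv //; last by move=> j; rewrite gt_eqF.
  rewrite -(unidiag_const uV a) !unidiagZ unidiagN unidiagD.
  by apply: unidiag_le => // j; rewrite !mxE; exact: aK.
(* Inversion reverses [X^-1 <= Z]. *)
have h4 : loewner (K *: invmx Z) (K *: X).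
  rewrite /loewner -scalerBr; apply: psdZ => //.
  have := loewner_invmx (posdef_invmx pX) pZ iXA.
  by rewrite /loewner invmxK.
have h5 := loewner_trans h2 h3.
split; split => //; [exact: loewner_trans h5 h4|exact: loewner_trans XA h1].
Qed.

End Hermitian.

(** * Monotonicity of order 2, tested on a rotated diagonal matrix with cosine [c] and sine [s] *)

Section TwoByTwo.
Variables (C : numClosedFieldType) (g : C -> C) (c s : C).
Hypothesis g_monotone : forall A B : 'M[C]_2, posdef A -> posdef B ->
  loewner A B -> loewner (spectral_calc g A) (spectral_calc g B).
Hypotheses (cR : c \is Num.real) (sR : s \is Num.real).
Hypothesis cs1 : c ^+ 2 + s ^+ 2 = 1.

Let rotation : 'M[C]_2 := \matrix_(i, j)
  if i == 0 then (if j == 0 then c else - s) else (if j == 0 then s else c).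
Let row2 (p q : C) : 'rV[C]_2 := \row_j if j == 0 then p else q.

Let cJ : c^*%R = c. Proof. exact/CrealP. Qed.
Let sJ : s^*%R = s. Proof. exact/CrealP. Qed.
Let c2 : 0 <= c ^+ 2. Proof. by rewrite real_exprn_even_ge0. Qed.
Let s2 : 0 <= s ^+ 2. Proof. by rewrite real_exprn_even_ge0. Qed.

Let mx2P (A B : 'M[C]_2) : A 0 0 = B 0 0 -> A 0 1 = B 0 1 ->
  A 1 0 = B 1 0 -> A 1 1 = B 1 1 -> A = B.
Proof.
move=> e00 e01 e10 e11; apply/matrixP => i j.
by case: (unliftP 0 i) => [i'|] ->; case: (unliftP 0 j) => [j'|] ->;
  rewrite ?ord1 //; rewrite (_ : lift 0 0 = 1) //; exact: val_inj.
Qed.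

Let rotation_unitary : rotation \is unitarymx.
Proof.
apply/unitarymxP; apply: mx2P; rewrite !(mxE, big_ord_recl, big_ord0) /=;
  rewrite ?rmorphN /= ?cJ ?sJ.
all: have e : s ^+ 2 = 1 - c ^+ 2 by rewrite -cs1 addrC addKr.
all: ring: e.
Qed.

Let unidiag_rotation (a b : C) :
  [/\ unidiag rotation (row2 a b) 0 0 = c ^+ 2 * a + s ^+ 2 * b,
      unidiag rotation (row2 a b) 0 1 = c * s * (b - a),
      unidiag rotation (row2 a b) 1 0 = c * s * (b - a) &
      unidiag rotation (row2 a b) 1 1 = s ^+ 2 * a + c ^+ 2 * b].
Proof.
by split; rewrite /unidiag mul_mx_diag !(mxE, big_ord_recl, big_ord0) /=;
  rewrite ?rmorphN /= ?cJ ?sJ; ring.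
Qed.

Let unidiag1E (a b : C) :
  [/\ unidiag 1%:M (row2 a b) 0 0 = a, unidiag 1%:M (row2 a b) 0 1 = 0,
      unidiag 1%:M (row2 a b) 1 0 = 0 & unidiag 1%:M (row2 a b) 1 1 = b].
Proof.
by split; rewrite /unidiag trmx1 map_mx1 mul1mx mulmx1 !mxE.
Qed.

Let map_row2 (a b : C) : map_mx g (row2 a b) = row2 (g a) (g b).
Proof. by apply/rowP => j; rewrite !mxE; case: ifP. Qed.

Let row2_gt0 (a b : C) : 0 < a -> 0 < b -> forall i, 0 < row2 a b 0 i.
Proof. by move=> a0 b0 i; rewrite mxE; case: ifP. Qed.

Let unitary1 : (1%:M : 'M[C]_2) \is unitarymx.
Proof. by apply/unitarymxP; rewrite trmx1 map_mx1 mulmx1. Qed.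

Let psd_rank1 (r p q : C) : 0 < r -> p \is Num.real -> q \is Num.real ->
  forall A : 'M[C]_2, A 0 0 = r^-1 * (p * p) -> A 0 1 = r^-1 * (p * q) ->
  A 1 0 = r^-1 * (p * q) -> A 1 1 = r^-1 * (q * q) -> psd A.
Proof.
move=> r0 pR qR A e00 e01 e10 e11.
have -> : A = r^-1 *: ((row2 p q) ^t* *m 1%:M *m ((row2 p q) ^t*) ^t*).
  have pJ : p^*%R = p by exact/CrealP.
  have qJ : q^*%R = q by exact/CrealP.
  rewrite trmxCK mulmx1; apply: mx2P;
    rewrite !(mxE, big_ord_recl, big_ord0) /= ?pJ ?qJ ?e00 ?e01 ?e10 ?e11;
    by rewrite addr0 // [q * p]mulrC.
apply: psdZ; first by rewrite invr_ge0; exact: ltW.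
apply: psd_congr; rewrite -diag_const_mx; apply: psd_diag => i.
by rewrite mxE ler01.
Qed.

(** The rotated [diag(a, b)] lies below [diag(p, q)] once [q] is large enough to absorb the
    off-diagonal entry [x]. Applying [g] keeps both eigenbases, and the (0, 0) entries give the
    claim, in which [q] has disappeared. *)
Lemma monotone2_le (a b e : C) : 0 < a -> 0 < b -> 0 < e ->
  c ^+ 2 * g a + s ^+ 2 * g b <= g (c ^+ 2 * a + s ^+ 2 * b + e).
Proof.
move=> a0 b0 e0; pose x := c * s * (b - a).
have xR : x \is Num.real.
  by do !apply: rpredM => //; apply: rpredB; exact: gtr0_real.
have xx : 0 <= x * x by rewrite -expr2 real_exprn_even_ge0.
set p := c ^+ 2 * a + s ^+ 2 * b + e.
(* The term [x^2 / e] makes the difference, up to a diagonal remainder, the rank one matrix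
   [e^-1 (e, -x)^* (e, -x)]. The final [e] is that remainder and makes [q] visibly positive. *)
pose q := s ^+ 2 * a + c ^+ 2 * b + e^-1 * (x * x) + e.
have p0 : 0 < p by rewrite ltr_wpDl // addr_ge0 // mulr_ge0 // ltW.
have q0 : 0 < q.
  rewrite ltr_wpDl // !addr_ge0 //; try by rewrite mulr_ge0 // ltW.
  by rewrite mulr_ge0 // invr_ge0 ltW.
have [B00 B01 B10 B11] := unidiag_rotation a b.
have [D00 D01 D10 D11] := unidiag1E p q.
have := @g_monotone (unidiag rotation (row2 a b)) (unidiag 1%:M (row2 p q)).
have pB := unidiag_posdef rotation_unitary (row2_gt0 a0 b0).
have pD := unidiag_posdef unitary1 (row2_gt0 p0 q0).
move=> /(_ pB pD); rewrite !spectral_calc_unidiag // !map_row2.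
have BD : loewner (unidiag rotation (row2 a b)) (unidiag 1%:M (row2 p q)).
  have q'E : q = s ^+ 2 * a + c ^+ 2 * b + e^-1 * (x * x) + e by [].
  move: (unidiag rotation _) (unidiag 1%:M _) B00 B01 B10 B11 D00 D01 D10 D11.
  move=> B D B00 B01 B10 B11 D00 D01 D10 D11.
  rewrite /loewner -[X in psd X](subrK (e *: diag_mx (row2 0 1))).
  apply: psdD; last first.
    apply: psdZ; [exact: ltW|apply: psd_diag => i].
    by rewrite mxE; case: ifP => _; rewrite ?ler01.
  have xNR : - x \is Num.real by rewrite realN.
  apply: (psd_rank1 e0 (gtr0_real e0) xNR);
    rewrite !mxE ?D00 ?D01 ?D10 ?D11 ?B00 ?B01 ?B10 ?B11 /= ?q'E /p /x;
    field; exact: lt0r_neq0.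
move=> /(_ BD) /(psd_entry_ge0 0).
have [] := unidiag1E (g p) (g q); have [] := unidiag_rotation (g a) (g b).
move: (unidiag rotation _) (unidiag 1%:M _) => B D BE _ _ _ DE _ _ _.
by rewrite !mxE BE DE subr_ge0.
Qed.

(** Dual comparison, with [diag(h, e)] below the rotated [diag(a, b)]. Lowering the (1, 1) entry by
    [e] leaves [r], and [h] is the Schur complement of [r]: the difference is the rank one matrix
    [r^-1 (x, r)^* (x, r)]. *)
Lemma monotone2_ge (a b e : C) : 0 < a -> 0 < b -> 0 < e ->
  let r := s ^+ 2 * a + c ^+ 2 * b - e in
  let h := c ^+ 2 * a + s ^+ 2 * b - r^-1 * (c * s * (b - a)) ^+ 2 in
  0 < r -> 0 < h -> g h <= c ^+ 2 * g a + s ^+ 2 * g b.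
Proof.
move=> a0 b0 e0 r h r0 h0; pose x := c * s * (b - a).
have xR : x \is Num.real.
  by do !apply: rpredM => //; apply: rpredB; exact: gtr0_real.
have rE : s ^+ 2 * a + c ^+ 2 * b - e = r by [].
have [B00 B01 B10 B11] := unidiag_rotation a b.
have [D00 D01 D10 D11] := unidiag1E h e.
have := @g_monotone (unidiag 1%:M (row2 h e)) (unidiag rotation (row2 a b)).
have pB := unidiag_posdef rotation_unitary (row2_gt0 a0 b0).
have pD := unidiag_posdef unitary1 (row2_gt0 h0 e0).
move=> /(_ pD pB); rewrite !spectral_calc_unidiag // !map_row2.
have BD : loewner (unidiag 1%:M (row2 h e)) (unidiag rotation (row2 a b)).
  move: (unidiag rotation _) (unidiag 1%:M _) B00 B01 B10 B11 D00 D01 D10 D11.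
  move=> B D B00 B01 B10 B11 D00 D01 D10 D11.
  apply: (psd_rank1 r0 xR (gtr0_real r0));
    rewrite !mxE ?D00 ?D01 ?D10 ?D11 ?B00 ?B01 ?B10 ?B11 ?rE /h -/x;
    field; exact: lt0r_neq0.
move=> /(_ BD) /(psd_entry_ge0 0).
have [] := unidiag1E (g h) (g e); have [] := unidiag_rotation (g a) (g b).
move: (unidiag rotation _) (unidiag 1%:M _) => B D BE _ _ _ DE _ _ _.
by rewrite !mxE BE DE subr_ge0.
Qed.

End TwoByTwo.

(** * Scalar inequalities on [[m, M]] and a one-sided derivative estimate *)

Section Scalar.
Variable R : realType.
Implicit Types (a b m M t x y z : R).

Lemma weighted_amgm a b x y : 0 < a -> 0 < b -> 0 <= x -> 0 <= y ->
  x + y = 1 -> a `^ x * b `^ y <= x * a + y * b.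
Proof.
move=> a0 b0 x0 y0 xy.
set u := _ * _; have u0 : 0 < u by rewrite mulr_gt0 ?powR_gt0.
(* This is [1 + v <= exp v] at [v = ln(z / u)]. In the weighted sum for [z = a] and [z = b] the
   logarithms cancel, since [ln u] is their weighted mean. *)
have tangent z : 0 < z -> u * (1 + (ln z - ln u)) <= z.
  move=> z0; have := expR_ge1Dx (ln z - ln u).
  by rewrite expRB !lnK ?posrE // ler_pdivlMr // mulrC.
have lu : ln u = x * ln a + y * ln b.
  by rewrite /u lnM ?posrE ?powR_gt0 // !ln_powR.
have := lerD (ler_wpM2l x0 (tangent a a0)) (ler_wpM2l y0 (tangent b b0)).
apply: le_trans; rewrite lu le_eqVlt; apply/orP; left; apply/eqP.
have -> : y = 1 - x by lra.
ring.
Qed.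

Section Interpolation.
Variables m M : R.
Hypotheses (m_gt0 : 0 < m) (m_lt_M : m < M).

Let kappa := (m^-1 - M^-1)^-1.

(** A weighted geometric mean of [M] and [m]; the weights are those for which the weighted harmonic
    mean of [M] and [m] is [t]. *)
Definition geom_interp t :=
  M `^ (kappa * (m^-1 - t^-1)) * m `^ (kappa * (t^-1 - M^-1)).

Let M_gt0 : 0 < M. Proof. exact: lt_trans m_lt_M. Qed.

(** Harmonic, geometric and arithmetic means of [M] and [m] with the same weights: the harmonic one
    is [t], the arithmetic one is [m + M - m M / t]. The lower bound is AM-GM for the inverses. *)
Lemma geom_interp_bounds t : m <= t -> t <= M ->
  t <= geom_interp t /\ geom_interp t <= (m + M) - m * M * t^-1.
Proof.
move=> mt tM; have t0 : 0 < t by exact: lt_le_trans mt.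
have d0 : 0 < m^-1 - M^-1 by rewrite subr_gt0 ltf_pV2 ?posrE.
have k0 : 0 <= kappa by rewrite invr_ge0 ltW.
rewrite /geom_interp; set x := kappa * _; set y := kappa * _.
have x0 : 0 <= x by rewrite mulr_ge0 // subr_ge0 lef_pV2 ?posrE.
have y0 : 0 <= y by rewrite mulr_ge0 // subr_ge0 lef_pV2 ?posrE.
have xy : x + y = 1.
  by rewrite /x /y -mulrDr addrA subrK mulVf // gt_eqF.
have Mm : M - m != 0 by rewrite subr_eq0 gt_eqF.
have nz : (M != 0) && (m != 0) && (t != 0) by rewrite !gt_eqF.
have kE : kappa = m * M / (M - m).
  rewrite /kappa; move: nz => /andP[/andP[? ?] ?].
  by field; rewrite Mm; apply/and3P.
split; last first.
  apply: le_trans (weighted_amgm M_gt0 m_gt0 x0 y0 xy) _.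
  rewrite le_eqVlt; apply/orP; left; apply/eqP; rewrite /x /y kE.
  by move: nz => /andP[/andP[? ?] ?]; field; apply/and4P.
have Mi : 0 < M^-1 by rewrite invr_gt0.
have mi : 0 < m^-1 by rewrite invr_gt0.
have := weighted_amgm Mi mi x0 y0 xy.
have pV z e : 0 < z -> z^-1 `^ e = (z `^ e)^-1.
  by move=> z0; rewrite -powR_inv1 ?ltW // -powRrM mulN1r powRN.
rewrite !pV // -invfM.
have -> : x / M + y / m = t^-1.
  rewrite /x /y kE.
  by move: nz => /andP[/andP[? ?] ?]; field; apply/and4P.
by rewrite lef_pV2 ?posrE // mulr_gt0 ?powR_gt0.
Qed.

(** [K(M/m, 2) = (m + M)^2 / (4 m M)] is the maximum of the concave quadratic [(m + M - m M t) t],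
    reached at [t = (m + M) / (2 m M)]. *)
Lemma kantorovich_bound t : 0 < t ->
  (m + M) - m * M * t <= kantorovich (M / m) * t^-1.
Proof.
move=> t0; rewrite ler_pdivlMr // -subr_ge0.
have -> : kantorovich (M / m) - (m + M - m * M * t) * t =
   (m + M - 2 * m * M * t) ^+ 2 / (4 * m * M).
  by rewrite /kantorovich; field; rewrite !gt_eqF.
by rewrite divr_ge0 ?sqr_ge0 // !mulr_ge0 // ltW.
Qed.

Lemma kantorovich_ge0 : 0 <= kantorovich (M / m).
Proof.
by rewrite /kantorovich divr_ge0 ?sqr_ge0 // mulr_ge0 // divr_ge0 ?ltW.
Qed.

End Interpolation.

(** By Carathéodory, [g (1 + v) = G (1 + v) v] with [G] continuous at 1 and [G 1 = L]. Dividing the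
    hypothesis by [t] gives [c <= G (1 + t q(t)) q(t)], and [t -> 0+] concludes. Letting [q] vary
    with [t] accommodates second order corrections. *)
Lemma derive_ge_chord (g q : R -> R) (L c r : R) :
  is_derive (1 : R) (1 : R) g L -> g 1 = 0 -> {for 0, continuous q} -> 0 < r ->
  (forall t, 0 < t -> t < r -> t * c <= g (1 + t * q t)) -> c <= L * q 0.
Proof.
move=> /is_derive1_caratheodory[G [gG Gc <-]] g1 qc r0 H.
have cvg : (G (1 + t * q t) * q t) @[t --> 0^'+] --> G 1 * q 0.
  apply: cvg_at_right_filter; apply: cvgM; last exact: qc.
  have pc : {for 0, continuous (fun t => 1 + t * q t)}.
    apply: continuousD; first exact: cvg_cst.
    by apply: continuousM => //; exact: cvg_id.
  have Gc' : {for 1 + 0 * q 0, continuous G} by rewrite mul0r addr0.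
  have -> : G 1 = (G \o (fun t => 1 + t * q t)) 0 by rewrite /= mul0r addr0.
  exact: (continuous_comp pc Gc').
rewrite -(cvg_lim (@norm_hausdorff _ _) cvg).
apply: limr_ge; first by apply/cvg_ex; eexists; exact: cvg.
near=> t.
have t0 : 0 < t by [].
have tr : t < r by near: t; exact: nbhs_right_lt.
have := H t t0 tr; have := gG (1 + t * q t); rewrite g1 subr0 => ->.
by rewrite addrAC subrr add0r mulrCA ler_pM2l.
Unshelve. all: by end_near.
Qed.

End Scalar.

Local Notation rc := (real_complex _).

(** * Scalar consequences of operator monotonicity and the bounds on [g] *)

Section OperatorMonotone.
Variables (R : realType) (g : R -> R).
Hypothesis g_monotone : operator_monotone g.
Implicit Types (a b e t : R).

Let gC (z : R[i]) : R[i] := (g (complex.Re z))%:C.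

Let gC_monotone (A B : 'M[R[i]]_2) : posdef A -> posdef B -> loewner A B ->
  loewner (spectral_calc gC A) (spectral_calc gC B).
Proof. exact: g_monotone. Qed.

Let realC a : a%:C \is @Num.real R[i].
Proof. by apply/complex_realP; exists a. Qed.

Let gCE a : gC a%:C = (g a)%:C. Proof. by []. Qed.

Let sqrtE a : 0 <= a -> (Num.sqrt a)%:C ^+ 2 = a%:C :> R[i].
Proof. by move=> a0; rewrite -(rmorphXn rc) /= sqr_sqrtr. Qed.

Let cs1 t : 0 <= t -> t <= 1 ->
  (Num.sqrt (1 - t))%:C ^+ 2 + (Num.sqrt t)%:C ^+ 2 = 1 :> R[i].
Proof.
move=> t0 t1; rewrite !sqrtE ?subr_ge0 //.
by rewrite -(rmorphD rc) /= subrK.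
Qed.

(** Concavity of [g] up to a slack [e], from the rotation with cosine [sqrt (1 - t)] and sine
    [sqrt t]. *)
Lemma operator_monotone_le t a b e : 0 <= t -> t <= 1 ->
  0 < a -> 0 < b -> 0 < e ->
  (1 - t) * g a + t * g b <= g ((1 - t) * a + t * b + e).
Proof.
move=> t0 t1 a0 b0 e0.
have := @monotone2_le _ gC _ _ gC_monotone (realC _) (realC _) (cs1 t0 t1)
  a%:C b%:C e%:C.
rewrite !ltcR => /(_ a0 b0 e0).
rewrite !sqrtE ?subr_ge0 //.
have -> : (1 - t)%:C * a%:C + t%:C * b%:C + e%:C =
    ((1 - t) * a + t * b + e)%:C by rewrite -!(rmorphM rc) -!(rmorphD rc).
rewrite !gCE -!(rmorphM rc) -(rmorphD rc).
by rewrite lecR.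
Qed.

Lemma operator_monotone_ge t a b e : 0 <= t -> t <= 1 ->
  0 < a -> 0 < b -> 0 < e ->
  let r := t * a + (1 - t) * b - e in
  let h := (1 - t) * a + t * b - r^-1 * ((1 - t) * t * (b - a) ^+ 2) in
  0 < r -> 0 < h -> g h <= (1 - t) * g a + t * g b.
Proof.
move=> t0 t1 a0 b0 e0 r h r0 h0.
have := @monotone2_ge _ gC _ _ gC_monotone (realC _) (realC _) (cs1 t0 t1)
  a%:C b%:C e%:C.
rewrite !ltcR => /(_ a0 b0 e0) /=.
rewrite !exprMn !sqrtE ?subr_ge0 //.
have -> : t%:C * a%:C + (1 - t)%:C * b%:C - e%:C = r%:C.
  by rewrite -!(rmorphM rc) -(rmorphD rc) -(rmorphB rc).
have -> : (1 - t)%:C * a%:C + t%:C * b%:C -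
    r%:C^-1 * ((1 - t)%:C * t%:C * (b%:C - a%:C) ^+ 2) = h%:C.
  rewrite -(rmorphB rc) -(rmorphXn rc) -(fmorphV rc) -!(rmorphM rc).
  by rewrite -(rmorphD rc) -(rmorphB rc).
rewrite !gCE -!(rmorphM rc) -(rmorphD rc).
by rewrite !ltcR lecR; apply.
Qed.

End OperatorMonotone.

Lemma classL_bounds (R : realType) (g : R -> R) : classL g ->
  forall y : R, 0 < y -> 1 - y^-1 <= g y /\ g y <= y - 1.
Proof.
move=> [mg g1 dg] y y0; split; last first.
  have q0 : y - 1 = 1 * (fun t : R => y - 1 + t) 0 by rewrite /= addr0 mul1r.
  rewrite q0; apply: (derive_ge_chord dg g1 _ ltr01) => [|t t0 t1].
    by apply: continuousD; [exact: cvg_cst|exact: cvg_id].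
  (* The slack [t^2] is positive but of second order, so it does not affect the limit slope
     [y - 1]. *)
  have := @operator_monotone_le _ _ mg t 1 y (t ^+ 2) (ltW t0) (ltW t1)
    ltr01 y0 (exprn_gt0 2 t0).
  rewrite g1 mulr0 add0r => /le_trans; apply.
  by rewrite (_ : (1 - t) * 1 + t * y + t ^+ 2 = 1 + t * (y - 1 + t)) //; ring.
pose r (t : R) := t + (1 - t) * y - t ^+ 2.
(* Chosen so that [1 + t q(t)] is the Schur complement [h] of [operator_monotone_ge] for [a = 1],
   [b = y] and [e = t^2]. *)
pose q (t : R) := (y - 1) * (1 - t ^+ 2) * (r t)^-1.
have q0 : 1 - y^-1 = q 0.
  rewrite /q /r !expr0n /= !subr0 add0r mulr1 mul1r mulrBl mul1r mulfV //.
  by rewrite gt_eqF.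
have r_cont : {for 0, continuous r}.
  apply: continuousB; last exact: exprn_continuous.
  apply: continuousD; first exact: cvg_id.
  apply: continuousM; last exact: cvg_cst.
  by apply: continuousB; [exact: cvg_cst|exact: cvg_id].
have qc : {for 0, continuous q}.
  apply: continuousM.
    apply: continuousM; first exact: cvg_cst.
    by apply: continuousB; [exact: cvg_cst|exact: exprn_continuous].
  apply: continuousV => //.
  by rewrite /r expr0n /= !subr0 add0r mul1r gt_eqF.
(* The lower bound on [g y] is an upper bound on [- g y], so the chord estimate is applied to
   [- g]. *)
have dNg : is_derive (1 : R) (1 : R) (fun t => - g t) (- 1).
  exact: is_deriveN.
have ng1 : (fun t => - g t) 1 = 0 by rewrite g1 oppr0.
(* [t < 1] makes [r t] positive; together with [t < y] it makes the Schur complement positive. *)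
have m0 : 0 < Num.min 1 y by rewrite lt_min ltr01.
suff : - g y <= - 1 * q 0 by rewrite mulN1r lerN2 q0.
apply: (derive_ge_chord dNg ng1 qc m0) => t t0.
rewrite lt_min => /andP[t1 ty].
have r0 : 0 < r t.
  rewrite /r (_ : _ - _ = t * (1 - t) + (1 - t) * y); last by ring.
  by rewrite addr_gt0 // mulr_gt0 // subr_gt0.
have := @operator_monotone_ge _ _ mg t 1 y (t ^+ 2) (ltW t0) (ltW t1)
  ltr01 y0 (exprn_gt0 2 t0).
rewrite mulr1 -/(r t) => /(_ r0).
have -> : (1 - t) * 1 + t * y - (r t)^-1 * ((1 - t) * t * (y - 1) ^+ 2) =
    1 + t * q t.
  rewrite /q /r; field; rewrite -/(r t); exact: lt0r_neq0.
rewrite g1 mulr0 add0r mulrN lerN2; apply.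
have -> : 1 + t * q t = (1 - t) * (y * (1 + t ^+ 2) + t * (y - t)) / r t.
  rewrite /q /r; field; rewrite -/(r t); exact: lt0r_neq0.
rewrite divr_gt0 // mulr_gt0 ?subr_gt0 // addr_gt0 // mulr_gt0 ?subr_gt0 //.
by rewrite ltr_pwDl // ?exprn_ge0 // ltW.
Qed.

(** * Transfer of the scalar bounds to matrices over [R[i]] *)

Theorem proposition2p2 (R : realType) (k n : nat) (g : R -> R)
    (w : 'I_n -> R) (A : 'I_n -> 'M[R[i]]_k) (m M : R) (X : 'M[R[i]]_k)
    (hg : classL g) (hw : weight_vector w)
    (m_gt0 : 0 < m) (m_lt_M : m < M)
    (A_pd : forall i, pdmx (A i))
    (A_ge : forall i, lemx (m%:C%:M) (A i))
    (A_le : forall i, lemx (A i) (M%:C%:M))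
    (hX : is_sigma g w A X) :
  (lemx (\sum_(i < n) (w i)%:C *: A i)
        (\sum_(i < n) (w i)%:C *: geom_interpmx m M (A i)) /\
   lemx (\sum_(i < n) (w i)%:C *: geom_interpmx m M (A i))
        ((kantorovich (M / m))%:C *: X)) /\
  (lemx X (\sum_(i < n) (w i)%:C *: geom_interpmx m M (A i)) /\
   lemx (\sum_(i < n) (w i)%:C *: geom_interpmx m M (A i))
        ((kantorovich (M / m))%:C *:
           invmx (\sum_(i < n) (w i)%:C *: invmx (A i)))).
Proof.
pose lift (f : R -> R) (z : R[i]) : R[i] := (f (complex.Re z))%:C.
pose phi := lift (geom_interp m M).
(* In the order of [R[i]] a positive element is real, so bounds over positive complex [z] reduce to
   real ones. *)
have posC (z : R[i]) : 0 < z -> exists2 x : R, 0 < x & z = x%:C.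
  move=> z0; exists (complex.Re z); last by rewrite RRe_real // gtr0_real.
  by rewrite -ltcR RRe_real // gtr0_real.
have geomE i : geom_interpmx m M (A i) = spectral_calc phi (A i).
  pose kappa := ((m^-1 - M^-1)^-1)%:C.
  have := @spectral_calc_inv_affine _ k (lift (powR M)) (lift (powR m)) kappa
    (m^-1)%:C (M^-1)%:C (A i) (A_pd i).
  rewrite (spectral_calc_ext (A_pd i) (f2 := phi)); first exact.
  move=> z /posC[x x0 ->].
  rewrite -(fmorphV rc) -!(rmorphB rc) -!(rmorphM rc).
  by rewrite /phi /lift.
have [w0 w1] := hw; have [pX eqX] := hX.
have gB (z : R[i]) : 0 < z -> 1 - z^-1 <= lift g z /\ lift g z <= z - 1.
  move=> /posC[x x0 ->]; have [h1 h2] := classL_bounds hg x0.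
  have -> : 1 - x%:C^-1 = (1 - x^-1)%:C.
    by rewrite (rmorphB rc) (fmorphV rc) (rmorph1 rc).
  have -> : x%:C - 1 = (x - 1)%:C by rewrite (rmorphB rc) (rmorph1 rc).
  by rewrite /lift !lecR.
have phiB (z : R[i]) : m%:C <= z -> z <= M%:C ->
    z <= phi z /\ phi z <= (m + M)%:C - (m * M)%:C * z^-1.
  move=> mz zM; have z0 : 0 < z by apply: lt_le_trans mz; rewrite ltcR.
  move: mz zM; have [x x0 ->] := posC _ z0; rewrite !lecR => mx xM.
  have [h1 h2] := geom_interp_bounds m_gt0 m_lt_M mx xM.
  by rewrite -(fmorphV rc) -(rmorphM rc) -(rmorphB rc) /phi /lift !lecR.
have KB (z : R[i]) : 0 < z ->
    (m + M)%:C - (m * M)%:C * z <= (kantorovich (M / m))%:C * z^-1.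
  move=> /posC[x x0 ->]; have := kantorovich_bound m_gt0 m_lt_M x0.
  by rewrite -(fmorphV rc) -!(rmorphM rc) -(rmorphB rc) lecR.
have K0 : 0 <= (kantorovich (M / m))%:C :> R[i].
  by rewrite ler0c kantorovich_ge0.
(* In an eigenbasis of [X] both claims concern the diagonal only: [x^(-1/2)] is real, and
   [x^(-1/2) x x^(-1/2) = 1]. *)
have S_spec : (invsqrtmx X) ^t* = invsqrtmx X /\
    invsqrtmx X *m X *m invsqrtmx X = 1%:M.
  have [V [d [uV d0 XE]]] := @posdef_unidiag _ k X pX.
  have -> : invsqrtmx X = unidiag V (map_mx (lift (fun t => t `^ (- 2^-1))) d).
    rewrite [X in invsqrtmx X]XE.
    exact: (spectral_calc_unidiag uV (lift (fun t => t `^ (- 2^-1))) d).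
  split.
    apply: unidiag_adj; apply/mxOverP => a b; rewrite mxE.
    by apply/complex_realP; eexists.
  rewrite [X in _ *m X *m _]XE !unidiagM // -(unidiag_const uV 1).
  congr unidiag; apply/rowP => j; rewrite !mxE.
  have [x x0 ->] := posC _ (d0 j); rewrite /lift -!(rmorphM rc).
  rewrite -(rmorph1 rc) powRN.
  have u0 : x `^ 2^-1 != 0 by rewrite gt_eqF ?powR_gt0.
  have uu : x `^ 2^-1 * x `^ 2^-1 = x.
    by rewrite powR12_sqrt ?ltW // -expr2 sqr_sqrtr // ltW.
  by rewrite /= -{2}uu mulKf // mulfV.
have [SS SXS] := S_spec.
have wC i : 0 <= (w i)%:C :> R[i] by rewrite ler0c ltW.
have w1C : \sum_i (w i)%:C = 1 :> R[i] by rewrite -(rmorph_sum rc) w1.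
have := @interp_bounds _ k _ (fun i => (w i)%:C) A X (invsqrtmx X) (lift g) phi
  _ _ _ _ _ gB phiB KB K0 SS SXS pX wC w1C A_pd A_ge A_le eqX.
have -> : \sum_i (w i)%:C *: geom_interpmx m M (A i) =
    \sum_i (w i)%:C *: spectral_calc phi (A i).
  by apply: eq_bigr => i _; rewrite geomE.
exact.
Qed.
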